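(* Let $1<p<\infty$ and let $(\nu_\varepsilon)_{\varepsilon>0}$ be a (fixed) family of radial measurable functions $\nu_\varepsilon:\mathbb{R}^d\setminus\{0\}\to[0,\infty)$ with $$\int_{\mathbb{R}^d}(1\wedge|h|^p)\nu_\varepsilon(h)\,dh=1\ \text{ for all }\varepsilon,\qquad\lim_{\varepsilon\to0}\int_{|h|>\delta}(1\wedge|h|^p)\nu_\varepsilon(h)\,dh=0\ \text{ for all }\delta>0 .$$ Let $\Omega\subset\mathbb{R}^d$ be open and bounded in one direction, say $\Omega\subset H_R=\{x\in\mathbb{R}^d:|x\cdot e|\le R\}$ with $R>0$ and $|e|=1$. Then there exist $\varepsilon_0=\varepsilon_0(d,p,\Omega)>0$ and $B=B(d,p,\Omega)>0$ such that for all $\varepsilon\in(0,\varepsilon_0)$ and $u\in C_c^\infty(\Omega)$, $$\|u\|^p_{L^p(\Omega)}\le B\int_{\mathbb{R}^d}\int_{\mathbb{R}^d}|u(x)-u(y)|^p\nu_\varepsilon(x-y)\,dy\,dx .$$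
   Context: $a\wedge b=\min(a,b)$. Functions in $C_c^\infty(\Omega)$ are extended by zero to $\mathbb{R}^d$. The family $(\nu_\varepsilon)_\varepsilon$ is fixed from the start, so the constants $\varepsilon_0,B$ are for this given family; they are independent of $\varepsilon$ and $u$. *)

(* Defs.v *)
From HB Require Import structures.
From mathcomp Require Import all_boot all_order all_algebra.
From mathcomp Require Import all_classical all_reals all_analysis.

Set Implicit Arguments.
Unset Strict Implicit.
Unset Printing Implicit Defensive.

Import Order.TTheory GRing.Theory Num.Theory.
Import numFieldNormedType.Exports.

Local Open Scope classical_set_scope.
Local Open Scope ring_scope.

(** Vectors of R^d are row vectors ['rV[R]_d]. The library norm on ['rV[R]_d] is
    the sup norm; it is only used through the topology it induces. *)

Definition dotv (R : realType) (d : nat) (x y : 'rV[R]_d) : R :=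
  \sum_(i < d) x 0 i * y 0 i.

Definition enorm (R : realType) (d : nat) (x : 'rV[R]_d) : R :=
  Num.sqrt (dotv x x).

(** Lebesgue measure on R^d is not in the library. It is built here as the
    d-fold product of the one-dimensional Lebesgue measure (on the Borel sets of
    [d.-tuple R]), completed by Caratheodory's construction. *)

Definition tcons (R : realType) (n : nat)
    (z : measurableTypeR R * n.-tuple (measurableTypeR R)) :
  n.+1.-tuple (measurableTypeR R) := [tuple of z.1 :: z.2].

Lemma measurable_tcons (R : realType) (n : nat) :
  measurable_fun [set: measurableTypeR R * n.-tuple (measurableTypeR R)]
    (@tcons R n).
Proof. exact: measurable_cons. Qed.

Section cons_measure.
Context (R : realType) (n : nat).
Variable m : {sigma_finite_measure set (n.-tuple (measurableTypeR R)) -> \bar R}.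

Definition cons_measure : set (n.+1.-tuple (measurableTypeR R)) -> \bar R :=
  pushforward (@lebesgue_measure R \x m)%E (@tcons R n).

Let cons_measure0 : cons_measure set0 = 0%E.
Proof. by rewrite /cons_measure /pushforward preimage_set0 measure0. Qed.

Let cons_measure_ge0 A : (0 <= cons_measure A)%E.
Proof. by rewrite /cons_measure /pushforward; exact: measure_ge0. Qed.

Let cons_measure_sigma_additive : semi_sigma_additive cons_measure.
Proof.
move=> F mF tF mUF; rewrite /cons_measure /pushforward preimage_bigcup.
apply: measure_semi_sigma_additive.
- by move=> k; rewrite -[X in measurable X]setTI; exact: measurable_tcons.
- apply/trivIsetP => /= i j _ _ ij; rewrite -preimage_setI.
  by move/trivIsetP : tF => /(_ _ _ _ _ ij) ->//; rewrite preimage_set0.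
- rewrite -preimage_bigcup -[X in measurable X]setTI.
  exact: measurable_tcons.
Qed.

HB.instance Definition _ := isMeasure.Build _ _ _ cons_measure
  cons_measure0 cons_measure_ge0 cons_measure_sigma_additive.

Let cons_measure_sigma_finite : sigma_finite setT cons_measure.
Proof.
have /sigma_finiteP[F [TF ndF Foo]] := sigma_finiteT (@lebesgue_measure R).
have /sigma_finiteP[G [TG ndG Goo]] := sigma_finiteT m.
have mh : measurable_fun [set: n.+1.-tuple (measurableTypeR R)]
    (fun t => thead t : measurableTypeR R).
  exact: measurable_tnth.
have mt : measurable_fun [set: n.+1.-tuple (measurableTypeR R)]
    (fun t => [tuple of behead t] : n.-tuple (measurableTypeR R)).
  exact: measurable_behead.
exists (fun k => [set t : n.+1.-tuple (measurableTypeR R) |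
    F k (thead t) /\ G k [tuple of behead t]]).
  apply/esym; rewrite -subTset => t _.
  have [i _ Fi] : (\bigcup_i F i) (thead t) by rewrite -TF.
  have [j _ Gj] : (\bigcup_i G i) [tuple of behead t] by rewrite -TG.
  exists (maxn i j) => //; split.
  - by move: Fi; exact/subsetPset/ndF/leq_maxl.
  - by move: Gj; exact/subsetPset/ndG/leq_maxr.
move=> k; have [mF Fk] := Foo k; have [mG Gk] := Goo k; split.
  apply: measurableI.
  - by rewrite -[X in measurable X]setTI; exact: mh.
  - by rewrite -[X in measurable X]setTI; exact: mt.
rewrite /cons_measure /pushforward (_ : _ @^-1` _ = F k `*` G k).
  by rewrite product_measure1E// lte_mul_pinfty// ge0_fin_numE.
have thE (x : R) t : thead (@tcons R n (x, t)) = x by [].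
have btE (x : R) t : [tuple of behead (@tcons R n (x, t))] = t.
  exact/val_inj.
by apply/seteqP; split=> -[x t] /=; rewrite thE btE.
Qed.

HB.instance Definition _ := Measure_isSigmaFinite.Build _ _ _ cons_measure
  cons_measure_sigma_finite.

End cons_measure.

Fixpoint lebesgue_tuple (R : realType) (n : nat) :
    {sigma_finite_measure set (n.-tuple (measurableTypeR R)) -> \bar R} :=
  match n with
  | 0%N => dirac [tuple]
  | n.+1 => cons_measure (lebesgue_tuple R n)
  end.

Definition row_of_tuple (R : realType) (d : nat)
  (t : d.-tuple (measurableTypeR R)) : 'rV[R]_d := \row_(i < d) tnth t i.

Definition lebesgue_outer (R : realType) (d : nat) (A : set 'rV[R]_d) : \bar R :=
  mu_ext (lebesgue_tuple R d) (@row_of_tuple R d @^-1` A).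

Section lebesgue_outer_measure.
Context (R : realType) (d : nat).

Let lebesgue_outer0 : @lebesgue_outer R d set0 = 0%E.
Proof. by rewrite /lebesgue_outer preimage_set0 outer_measure0. Qed.

Let lebesgue_outer_ge0 A : (0 <= @lebesgue_outer R d A)%E.
Proof. by rewrite /lebesgue_outer; exact: outer_measure_ge0. Qed.

Let le_lebesgue_outer :
  {homo @lebesgue_outer R d : A B / A `<=` B >-> (A <= B)%E}.
Proof. by move=> A B AB; apply: le_outer_measure; exact: preimage_subset. Qed.

Let lebesgue_outer_sigma_subadditive : sigma_subadditive (@lebesgue_outer R d).
Proof.
move=> F; rewrite /lebesgue_outer preimage_bigcup.
exact: outer_measure_sigma_subadditive.
Qed.

HB.instance Definition _ := isOuterMeasure.Build R 'rV[R]_d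
  (@lebesgue_outer R d) lebesgue_outer0 lebesgue_outer_ge0 le_lebesgue_outer
  lebesgue_outer_sigma_subadditive.

End lebesgue_outer_measure.

(** ['rV[R]_d] equipped with the sigma-algebra of Lebesgue measurable sets. *)
Definition lebRd (R : realType) (d : nat) :=
  caratheodory_type (@lebesgue_outer R d).
HB.instance Definition _ (R : realType) (d : nat) := Measurable.on (lebRd R d).

Definition lebesgueRd (R : realType) (d : nat) : set (lebRd R d) -> \bar R :=
  @lebesgue_outer R d.

Section lebesgueRd_measure.
Context (R : realType) (d : nat).

Let lebesgueRd0 : @lebesgueRd R d set0 = 0%E.
Proof. exact: outer_measure0. Qed.

Let lebesgueRd_ge0 A : (0 <= @lebesgueRd R d A)%E.
Proof. exact: outer_measure_ge0. Qed.

Let lebesgueRd_sigma_additive : semi_sigma_additive (@lebesgueRd R d).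
Proof. exact: caratheodory_measure_sigma_additive. Qed.

HB.instance Definition _ := isMeasure.Build _ (lebRd R d) R (@lebesgueRd R d)
  lebesgueRd0 lebesgueRd_ge0 lebesgueRd_sigma_additive.

End lebesgueRd_measure.

Definition intRd (R : realType) (d : nat) (D : set 'rV[R]_d)
    (f : 'rV[R]_d -> \bar R) : \bar R :=
  (\int[@lebesgueRd R d]_(x in (D : set (lebRd R d))) f x)%E.

Definition measurable_funRd (R : realType) (d : nat) (D : set 'rV[R]_d)
    (f : 'rV[R]_d -> R) : Prop :=
  measurable_fun (D : set (lebRd R d)) (f : lebRd R d -> R).

(** [normLp p D f] is the norm of [f] in L^p(D). *)
Definition normLp (R : realType) (d : nat) (p : R) (D : set 'rV[R]_d)
    (f : 'rV[R]_d -> R) : \bar R :=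
  'N[@lebesgueRd R d]_(p%:E)[EFin \o ((f \_ D) : lebRd R d -> R)]%E.

Fixpoint Ck (R : realType) (d : nat) (k : nat) (f : 'rV[R]_d -> R) : Prop :=
  match k with
  | 0%N => continuous f
  | k.+1 => continuous f /\
      forall i : 'I_d, (forall x, derivable f x (delta_mx 0 i)) /\
        Ck k (fun x => 'D_(delta_mx 0 i) f x)
  end.

(** C_c^infty(Omega), each function being identified with its extension by zero
    to R^d. *)
Definition Cc_infty (R : realType) (d : nat) (Omega : set 'rV[R]_d)
    (u : 'rV[R]_d -> R) : Prop :=
  let supp := closure [set x | u x != 0] in
  [/\ forall k, Ck k u, compact supp & supp `<=` Omega].

Definition radial (R : realType) (d : nat) (f : 'rV[R]_d -> R) : Prop :=
  forall x y, x != 0 -> y != 0 -> enorm x = enorm y -> f x = f y.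

(** The functions [nu eps] live on R^d minus the origin: nothing is required of
    the value at [0], which does not affect any of the integrals below since the
    factors multiplying [nu eps 0] vanish. *)
Definition kernel_family (R : realType) (d : nat) (p : R)
    (nu : R -> 'rV[R]_d -> R) : Prop :=
  let w eps h := ((Num.min 1 (enorm h `^ p) * nu eps h)%:E) in
  [/\ forall eps, 0 < eps ->
        [/\ measurable_funRd [set h | h != 0] (nu eps),
            forall h, h != 0 -> 0 <= nu eps h,
            radial (nu eps) &
            intRd setT (w eps) = 1%E]
    & forall delta, 0 < delta ->
        intRd [set h | delta < enorm h] (w eps) @[eps --> 0^'+] --> 0%E].

(* Main.v *)
From HB Require Import structures.
Require Import Defs.
From mathcomp Require Import all_boot all_order all_algebra perm.
From mathcomp Require Import all_classical all_reals all_analysis.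
From mathcomp Require Import measurable_realfun.
From mathcomp Require Import ring lra.

Import Order.TTheory GRing.Theory Num.Theory.
Import numFieldNormedType.Exports.

Local Open Scope classical_set_scope.
Local Open Scope ring_scope.

(** The inequality is proved directly, with explicit constants and without any
compactness argument.

Write omega(h) for the integral of |u(x) - u(x - h)|^p over x. Substituting
y = x - h and applying Tonelli's theorem turns the double integral of the
statement into the integral of nu(h) omega(h) over h ([energy_shift]), so it is
enough to bound omega(h) from below.

The function u vanishes outside a slab of width 2r in the direction e. Once a
vector g satisfies |g.e| > 2r, the translate of u by g lives off the support
of u, whence omega(g) is at least the p-th power of the L^p norm of u
([shift_energy_disjoint]). A short vector h is brought to such a g by repeated
doubling, and convexity of the p-th power gives omega(2h) <= 2^p omega(h), with
no loss in the exponent ([shift_energy_double]). Stopping at the first k for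
which 2^k |h.e| > 2r yields
      |h.e|^p |u|_p^p <= M^p omega(h),   for |h| <= 1 and M = d + 4r
([shift_energy_lower]). Integrating against nu leaves only the task of bounding
from below the integral of |h.e|^p nu(h) over the unit ball.

For a radial kernel this directional moment dominates the moment of |h|^p up to
a constant. The full rotation group is not needed: flipping the signs of all
coordinates but the i-th and using midpoint convexity reduces h.e to h_i e_i
([moment_coord_le]), exchanging coordinates shows that all coordinates have the
same moment ([moment_coord_swap]), and |h|^p <= d^p sum_i |h_i|^p
([moment_enorm_le]). Any i with e_i different from 0 serves. Finally the moment
of |h|^p over the unit ball is at least 1/2 as soon as less than half of the
unit mass of (1 /\ |h|^p) nu(h) lies outside the unit ball, which the
concentration hypothesis provides for all small epsilon
([moment_unit_ball_ge]).

The measure theory behind this is the invariance of the completed Lebesgue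
measure under signed permutations of the coordinates combined with translations
([intRd_signed_perm]); that single family of maps contains the translations,
the reflections h -> x - h, the sign flips and the exchanges used above. It
also requires sigma-finiteness, for Tonelli's theorem, and the measurability of
continuous functions. *)

(** * Lebesgue measure of boxes *)

Definition box {R : realType} {n : nat} (A : 'I_n -> set R) :
  set (n.-tuple (measurableTypeR R)) := [set t | forall i, A i (tnth t i)].

Lemma measurable_box (R : realType) (n : nat)
    (A : 'I_n -> set (measurableTypeR R)) :
  (forall i, measurable (A i)) -> measurable (box A).
Proof.
move=> mA; rewrite (_ : box A = \bigcap_(i in setT) ((@tnth n _)^~ i @^-1` A i)).
  apply: fin_bigcap_measurable => [|i _]; first exact: finite_finset.
  rewrite -[X in measurable X]setTI.
  exact: measurable_tnth.
by apply/seteqP; split => t /= h i; [move=> _; exact: h|exact: (h i I)].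
Qed.

Lemma lebesgue_tuple_box (R : realType) (n : nat)
    (A : 'I_n -> set (measurableTypeR R)) :
  (forall i, measurable (A i)) ->
  lebesgue_tuple R n (box A) = (\prod_(i < n) lebesgue_measure (A i))%E.
Proof.
elim: n A => [|n IH] A mA.
  rewrite big_ord0 /= diracE mem_set//.
  by case.
rewrite /= /cons_measure /pushforward.
rewrite (_ : _ @^-1` _ = A ord0 `*` box (fun i => A (lift ord0 i))).
  rewrite product_measure1E//; last exact: measurable_box.
  by rewrite big_ord_recl IH.
apply/seteqP; split => -[x t] /= h.
  split; first exact: (h ord0).
  by move=> i; have := h (lift ord0 i); rewrite /tcons tnthS.
move=> i; case: (unliftP ord0 i) => [j ->|->]; last exact: h.1.
by rewrite /tcons tnthS; apply: h.2.
Qed.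

(** Boxes are stable under intersection and generate the product sigma-algebra,
so a measure that is finite on the cubes centred at the origin is determined by
its values on boxes. *)
Lemma tuple_measure_unique (R : realType) (n : nat)
    (m1 m2 : {measure set (n.-tuple (measurableTypeR R)) -> \bar R}) :
  (forall A : 'I_n -> set (measurableTypeR R),
     (forall i, measurable (A i)) -> m1 (box A) = m2 (box A)) ->
  (forall k : nat, (m1 (box (fun=> `]- (k%:R : R), k%:R[%classic))%R < +oo)%E) ->
  forall A, measurable A -> m1 A = m2 A.
Proof.
move=> m12 m1oo.
pose G := [set X : set (n.-tuple (measurableTypeR R)) |
  exists2 A : 'I_n -> set (measurableTypeR R), forall i, measurable (A i) & X = box A].
apply: (measure_unique G (fun k => box (fun=> `]- (k%:R : R), k%:R[%classic))).
- rewrite eqEsubset; split.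
    apply: smallest_sub; first exact: smallest_sigma_algebra.
    move=> X; rewrite -bigcup_seq => -[i _] [B mB <-].
    apply: sub_sigma_algebra.
    exists (fun j => if j == i then B else setT) => [j|]; first by case: ifP.
    rewrite setTI; apply/seteqP; split => t /= h.
      by move=> j; case: eqP => [->|].
    by have := h i; rewrite eqxx.
  apply: smallest_sub; first exact: sigma_algebra_measurable.
  by move=> _ [A mA ->]; exact: measurable_box.
- move=> _ _ [A mA ->] [B mB ->]; exists (fun i => A i `&` B i) => [i|].
    exact: measurableI.
  apply/seteqP; split => t /=; first by move=> [h1 h2] i; split.
  by move=> h; split => i; have [] := h i.
- move=> k; exists (fun=> `]- (k%:R : R), k%:R[%classic) => // i.
- apply/seteqP; split => // t _.
  pose M := \sum_i `|tnth t i|.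
  exists (Num.truncn M).+1 => // i /=.
  have h : `|tnth t i| < (Num.truncn M).+1%:R.
    apply: le_lt_trans (truncnS_gt _).
    by rewrite /M (bigD1 i)//= lerDl sumr_ge0.
  by rewrite in_itv/= -ltr_norml.
- by move=> _ [A mA ->]; exact: m12.
- exact: m1oo.
Qed.

Lemma lebesgue_measure_affine (R : realType) (s : bool) (a : R)
    (A : set (measurableTypeR R)) : measurable A ->
  lebesgue_measure ((fun x : R => (-1) ^+ s * x + a) @^-1` A) = lebesgue_measure A.
Proof.
move=> mA.
have mf : measurable_fun [set: measurableTypeR R]
    ((fun x => (-1) ^+ s * x + a) : measurableTypeR R -> measurableTypeR R).
  by apply: measurable_funD => //; apply: measurable_funM.
pose f : {mfun measurableTypeR R >-> measurableTypeR R} :=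
  HB.pack (fun x : measurableTypeR R => (-1) ^+ s * x + a : measurableTypeR R)
  (isMeasurableFun.Build _ _ _ _ _ mf).
apply/esym; suff /(_ A mA) : forall B, measurable B ->
    lebesgue_measure B = pushforward lebesgue_measure f B by [].
apply: lebesgue_measure_unique => /=.
move=> _ [[b c] _ <-]; rewrite /pushforward/=.
case: s {mf f} => /=.
  rewrite (_ : _ @^-1` _ = `[a - c, a - b[%classic).
    rewrite !lebesgue_measure_itv/= !lte_fin.
    rewrite (_ : (a - c < a - b) = (b < c)); last by apply/idP/idP => ?; lra.
    by case: ifPn => // _; rewrite -!EFinD; congr EFin; ring.
  by apply/seteqP; split => x /=; rewrite !in_itv/= => /andP[? ?]; apply/andP; split; lra.
rewrite (_ : _ @^-1` _ = `]b - a, c - a]%classic).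
  rewrite !lebesgue_measure_itv/= !lte_fin.
  rewrite (_ : (b - a < c - a) = (b < c)); last by apply/idP/idP => ?; lra.
  by case: ifPn => // _; rewrite -!EFinD; congr EFin; ring.
by apply/seteqP; split => x /=; rewrite !in_itv/= => /andP[? ?]; apply/andP; split; lra.
Qed.

(** * Invariance under signed permutations and translations *)

(** Pulling back a measurable cover of [A] gives a cover of the preimage of [A]
with the same total mass. For an invertible map this inequality, applied to the
map and to its inverse, becomes invariance of the outer measure on all sets,
measurable or not. *)
Lemma mu_ext_preimage_le (disp : measure_display) (R : realType) (T : measurableType disp)
    (mu : {measure set T -> \bar R}) (f : T -> T) :
  measurable_fun setT f -> (forall A, measurable A -> mu (f @^-1` A) = mu A) ->
  forall A, (mu_ext mu (f @^-1` A) <= mu_ext mu A)%E.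
Proof.
move=> mf muf A; apply: le_ereal_inf_tmp => _ [F [mF AF] <-].
apply: ereal_inf_lbound; exists (fun k => f @^-1` F k).
  split=> [k|]; first by rewrite -[X in measurable X]setTI; exact: mf.
  by rewrite -preimage_bigcup; exact: preimage_subset.
by apply: eq_eseriesr => k _; rewrite muf.
Qed.

(** Translations, coordinate reflections and coordinate permutations, gathered in
one family closed under inverses, so that invariance is proved only once. *)
Definition signed_perm {R : realType} {d : nat} (q : 'S_d) (s : 'I_d -> bool)
    (a : 'rV[R]_d) (x : 'rV[R]_d) : 'rV[R]_d :=
  \row_i ((-1) ^+ s i * x 0 (q i) + a 0 i).

Definition signed_perm_inv {R : realType} {d : nat} (q : 'S_d)
    (s : 'I_d -> bool) (a : 'rV[R]_d) : 'rV[R]_d -> 'rV[R]_d :=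
  signed_perm q^-1 (s \o (q^-1)%g)
    (\row_i - ((-1) ^+ s ((q^-1)%g i) * a 0 ((q^-1)%g i))).

Lemma signed_permK (R : realType) (d : nat) (q : 'S_d) (s : 'I_d -> bool)
    (a : 'rV[R]_d) :
  cancel (signed_perm q s a) (signed_perm_inv q s a).
Proof.
move=> x; apply/rowP => i; rewrite !mxE/= permKV.
by rewrite mulrDr mulrA -expr2 sqrr_sign mul1r addrK.
Qed.

Lemma signed_permVK (R : realType) (d : nat) (q : 'S_d) (s : 'I_d -> bool)
    (a : 'rV[R]_d) :
  cancel (signed_perm_inv q s a) (signed_perm q s a).
Proof.
move=> x; apply/rowP => i; rewrite !mxE/= permK.
by rewrite mulrDr mulrN !mulrA -expr2 sqrr_sign !mul1r addrNK.
Qed.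

(** The preimage of a box is the box of the permuted one-dimensional preimages,
whose Lebesgue measures have the same product. *)
Lemma lebesgue_tuple_signed_perm (R : realType) (d : nat) (q : 'S_d) (s : 'I_d -> bool)
    (a : 'rV[R]_d) :
  let T (t : d.-tuple (measurableTypeR R)) : d.-tuple (measurableTypeR R) :=
    [tuple (-1) ^+ s i * tnth t (q i) + a 0 i | i < d] in
  measurable_fun setT T /\
  forall A, measurable A -> lebesgue_tuple R d (T @^-1` A) = lebesgue_tuple R d A.
Proof.
move=> T.
have mT : measurable_fun setT T.
  apply/measurable_fun_tnthP => i.
  rewrite (_ : _ \o _ = (fun t => (-1) ^+ s i * tnth t (q i) + a 0 i)); last first.
    by apply/funext => t /=; rewrite tnth_mktuple.
  apply: measurable_funD => //; apply: measurable_funM => //.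
  exact: measurable_tnth.
split => //.
pose f : {mfun d.-tuple (measurableTypeR R) >-> d.-tuple (measurableTypeR R)} :=
  HB.pack T (isMeasurableFun.Build _ _ _ _ _ mT).
suff: forall A, measurable A ->
    lebesgue_tuple R d A = pushforward (lebesgue_tuple R d) f A.
  by move=> h A mA; rewrite (h A mA).
apply: tuple_measure_unique => [A mA|k] /=.
  rewrite /pushforward (_ : _ @^-1` _ = box (fun j =>
      (fun x : R => (-1) ^+ s ((q^-1)%g j) * x + a 0 ((q^-1)%g j)) @^-1` A ((q^-1)%g j))); last first.
    apply/seteqP; split => t /= h i.
      by have := h ((q^-1)%g i); rewrite tnth_mktuple permKV.
    by have := h (q i); rewrite tnth_mktuple/= permK.
  rewrite !lebesgue_tuple_box//.
    rewrite [RHS](reindex_inj (@perm_inj _ q))/=; apply: eq_bigr => i _.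
    by rewrite permK lebesgue_measure_affine.
  move=> i; rewrite -[X in measurable X]setTI.
  have mg : measurable_fun [set: measurableTypeR R] (fun x : measurableTypeR R =>
      (-1) ^+ s ((q^-1)%g i) * x + a 0 ((q^-1)%g i) : measurableTypeR R).
    by apply: measurable_funD => //; apply: measurable_funM.
  exact: mg.
rewrite lebesgue_tuple_box//.
under eq_bigr do rewrite lebesgue_measure_itv/=.
rewrite ltey_eq; apply/orP; left.
apply: (big_ind (fun x : \bar R => x \is a fin_num)) => // [x y|i _].
  exact: fin_numM.
by case: ifP.
Qed.

Lemma lebesgue_outer_signed_perm (R : realType) (d : nat) (q : 'S_d) (s : 'I_d -> bool)
    (a : 'rV[R]_d) (A : set 'rV[R]_d) :
  lebesgue_outer (signed_perm q s a @^-1` A) = lebesgue_outer A.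
Proof.
have key q' s' (a' : 'rV[R]_d) B : (lebesgue_outer (signed_perm q' s' a' @^-1` B) <= lebesgue_outer B)%E.
  have [mT muT] := lebesgue_tuple_signed_perm R d q' s' a'.
  rewrite /lebesgue_outer -(_ : (fun t : d.-tuple (measurableTypeR R) =>
      [tuple (-1) ^+ s' i * tnth t (q' i) + a' 0 i | i < d]) @^-1`
        (@row_of_tuple R d @^-1` B) =
      @row_of_tuple R d @^-1` (signed_perm q' s' a' @^-1` B)).
    exact: (mu_ext_preimage_le _ _ _ _ _ mT muT (@row_of_tuple R d @^-1` B)).
  apply/funext => t; rewrite /preimage/=; congr (B _).
  by apply/rowP => i; rewrite !mxE tnth_mktuple.
apply/eqP; rewrite eq_le key/=.
rewrite -[leLHS](_ : lebesgue_outer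
    (signed_perm_inv q s a @^-1` (signed_perm q s a @^-1` A)) = _).
  exact: key.
by congr lebesgue_outer; apply/funext => x /=; rewrite /preimage/= signed_permVK.
Qed.

Lemma measurable_lebRdP (R : realType) (d : nat) (A : set 'rV[R]_d) :
  measurable (A : set (lebRd R d)) <->
  caratheodory_measurable (@lebesgue_outer R d) A.
Proof. by []. Qed.

(** Carathéodory measurability is expressed by the outer measure alone, hence is
transported by any bijection preserving the outer measure. Borel measurability
of the map would not suffice here, since [lebRd] carries the completed
sigma-algebra on both sides. *)
Lemma measurable_signed_perm (R : realType) (d : nat) (q : 'S_d) (s : 'I_d -> bool)
    (a : 'rV[R]_d) :
  measurable_fun [set: lebRd R d] (signed_perm q s a : lebRd R d -> lebRd R d).
Proof.
move=> _ A /measurable_lebRdP mA; rewrite setTI; apply/measurable_lebRdP => X.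
have E := lebesgue_outer_signed_perm R d q s a.
pose Y := signed_perm_inv q s a @^-1` X.
have XY : X = signed_perm q s a @^-1` Y.
  by apply/funext => x; rewrite /Y /preimage/= signed_permK.
have := mA Y; rewrite -(E Y) -(E (Y `&` A)) -(E (Y `&` ~` A)).
by rewrite XY.
Qed.

Lemma intRd_signed_perm (R : realType) (d : nat) (q : 'S_d) (s : 'I_d -> bool)
    (a : 'rV[R]_d) (f : 'rV[R]_d -> \bar R) :
  measurable_fun [set: lebRd R d] (f : lebRd R d -> \bar R) ->
  (forall x, 0 <= f x)%E ->
  intRd setT (f \o signed_perm q s a) = intRd setT f.
Proof.
move=> mf f0; rewrite /intRd.
have mT := measurable_signed_perm R d q s a.
have := ge0_integral_pushforward mT (@lebesgueRd R d) measurableT mf (fun y _ => f0 y).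
rewrite preimage_setT => <-.
apply: eq_measure_integral => A mA _.
exact: lebesgue_outer_signed_perm.
Qed.

(** * Borel sets and sigma-finiteness *)

Lemma measurable_lebRd_row (R : realType) (d : nat) (A : set 'rV[R]_d) :
  measurable (@row_of_tuple R d @^-1` A) -> measurable (A : set (lebRd R d)).
Proof.
move=> mA; apply/measurable_lebRdP => X; rewrite /lebesgue_outer !preimage_setI -preimage_setC.
apply: (sub_caratheodory (lebesgue_tuple R d)).
exact: sub_sigma_algebra.
Qed.

Lemma lebesgueRd_row (R : realType) (d : nat) (A : set 'rV[R]_d) :
  measurable (@row_of_tuple R d @^-1` A) ->
  lebesgueRd A = lebesgue_tuple R d (@row_of_tuple R d @^-1` A).
Proof. by move=> mA; rewrite /lebesgueRd /lebesgue_outer measurable_mu_extE. Qed.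

Definition tuple_of_row {R : realType} {d : nat} (x : 'rV[R]_d) : d.-tuple (measurableTypeR R) :=
  [tuple x 0 i | i < d].

Lemma row_of_tupleK (R : realType) (d : nat) : cancel (@row_of_tuple R d) (@tuple_of_row R d).
Proof. by move=> t; apply: eq_from_tnth => i; rewrite tnth_mktuple mxE. Qed.

Lemma sigma_finite_lebesgueRd (R : realType) (d : nat) :
  sigma_finite [set: lebRd R d] (@lebesgueRd R d).
Proof.
have [F TF Foo] := sigma_finiteT (lebesgue_tuple R d).
have FE k : @row_of_tuple R d @^-1` (@tuple_of_row R d @^-1` F k) = F k.
  by apply/funext => t; rewrite /preimage/= row_of_tupleK.
exists (fun k => @tuple_of_row R d @^-1` F k).
  by rewrite -preimage_bigcup -TF preimage_setT.
move=> k; have [mF Fk] := Foo k; split.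
  by apply: measurable_lebRd_row; rewrite FE.
by rewrite lebesgueRd_row FE.
Qed.

HB.instance Definition _ (R : realType) (d : nat) :=
  Measure_isSigmaFinite.Build _ (lebRd R d) R (@lebesgueRd R d)
    (sigma_finite_lebesgueRd R d).

Lemma measurable_coord (R : realType) (d : nat) (i : 'I_d) :
  measurable_fun [set: lebRd R d] ((fun x : 'rV[R]_d => x 0 i) : lebRd R d -> R).
Proof.
move=> _ A mA; rewrite setTI; apply: measurable_lebRd_row.
rewrite (_ : _ @^-1` _ = (@tnth d _)^~ i @^-1` A).
  by rewrite -[X in measurable X]setTI; exact: measurable_tnth.
by apply/seteqP; split => t; rewrite /preimage/= mxE.
Qed.

(** * Integrals of nonnegative functions *)

Definition emeasurableRd {R : realType} {d : nat} (f : 'rV[R]_d -> \bar R) : Prop :=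
  measurable_fun [set: lebRd R d] (f : lebRd R d -> \bar R).

Lemma intRd_ge0 (R : realType) (d : nat) (f : 'rV[R]_d -> \bar R) :
  (forall x, 0 <= f x)%E -> (0 <= intRd setT f)%E.
Proof. by move=> f0; apply: integral_ge0 => x _; exact: f0. Qed.

Lemma intRdZl (R : realType) (d : nat) (k : \bar R) (f : 'rV[R]_d -> \bar R) :
  emeasurableRd f -> (forall x, 0 <= f x)%E -> (0 <= k)%E ->
  intRd setT (fun x => k * f x)%E = (k * intRd setT f)%E.
Proof.
move=> mf f0 k0.
exact: (ge0_integralZl (@lebesgueRd R d) measurableT mf (fun x _ => f0 x) k0).
Qed.

Lemma intRdD (R : realType) (d : nat) (f g : 'rV[R]_d -> \bar R) :
  emeasurableRd f -> emeasurableRd g ->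
  (forall x, 0 <= f x)%E -> (forall x, 0 <= g x)%E ->
  intRd setT (fun x => f x + g x)%E = (intRd setT f + intRd setT g)%E.
Proof.
move=> mf mg f0 g0.
exact: (ge0_integralD (@lebesgueRd R d) measurableT (fun x _ => f0 x) mf
  (fun x _ => g0 x) mg).
Qed.

Lemma le_intRd (R : realType) (d : nat) (f g : 'rV[R]_d -> \bar R) :
  emeasurableRd f -> emeasurableRd g ->
  (forall x, 0 <= f x)%E -> (forall x, f x <= g x)%E ->
  (intRd setT f <= intRd setT g)%E.
Proof.
move=> mf mg f0 fg.
exact: (ge0_le_integral (@lebesgueRd R d) measurableT (fun x _ => f0 x) mf mg
  (fun x _ => fg x)).
Qed.

Lemma intRd_sum (R : realType) (d : nat) (I : Type) (s : seq I)
    (f : I -> 'rV[R]_d -> \bar R) :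
  (forall i, emeasurableRd (f i)) -> (forall i x, 0 <= f i x)%E ->
  (intRd setT (fun x => \sum_(i <- s) f i x) = \sum_(i <- s) intRd setT (f i))%E.
Proof.
move=> mf f0.
exact: (ge0_integral_sum (@lebesgueRd R d) measurableT mf (fun i x _ => f0 i x)).
Qed.

Lemma intRd_fubini (R : realType) (d : nat) (f : 'rV[R]_d -> 'rV[R]_d -> \bar R) :
  measurable_fun [set: lebRd R d * lebRd R d] (fun z => f z.1 z.2) ->
  (forall x y, 0 <= f x y)%E ->
  intRd setT (fun x => intRd setT (f x)) =
  intRd setT (fun y => intRd setT (f^~ y)).
Proof.
move=> mf f0.
exact: (@fubini_tonelli _ _ (lebRd R d) (lebRd R d) R
  (@lebesgueRd R d) (@lebesgueRd R d) (fun z => f z.1 z.2) mf (fun z => f0 z.1 z.2)).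
Qed.

Lemma emeasurableRd_fubini (R : realType) (d : nat) (f : 'rV[R]_d -> 'rV[R]_d -> \bar R) :
  measurable_fun [set: lebRd R d * lebRd R d] (fun z => f z.1 z.2) ->
  (forall x y, 0 <= f x y)%E ->
  emeasurableRd (fun y => intRd setT (f^~ y)).
Proof.
move=> mf f0.
exact: (@measurable_fun_fubini_tonelli_G _ _ (lebRd R d) (lebRd R d) R
  (@lebesgueRd R d) (fun z => f z.1 z.2) mf (fun z => f0 z.1 z.2)).
Qed.

Lemma emeasurableRd_EFin (R : realType) (d : nat) (f : 'rV[R]_d -> R) :
  measurable_funRd setT f -> emeasurableRd (fun x => (f x)%:E).
Proof. by move=> mf; apply/measurable_EFinP. Qed.

Lemma emeasurableRdD (R : realType) (d : nat) (f g : 'rV[R]_d -> \bar R) :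
  emeasurableRd f -> emeasurableRd g ->
  emeasurableRd (fun x => f x + g x)%E.
Proof. by move=> mf mg; exact: emeasurable_funD. Qed.

Lemma emeasurableRdZ (R : realType) (d : nat) (k : \bar R) (f : 'rV[R]_d -> \bar R) :
  emeasurableRd f -> emeasurableRd (fun x => k * f x)%E.
Proof. by move=> mf; exact: (emeasurable_funM (measurable_cst k) mf). Qed.

Lemma emeasurableRd_signed_perm (R : realType) (d : nat) (q : 'S_d)
    (s : 'I_d -> bool) (a : 'rV[R]_d) (f : 'rV[R]_d -> \bar R) :
  emeasurableRd f -> emeasurableRd (f \o signed_perm q s a).
Proof.
move=> mf; exact: (measurableT_comp mf (measurable_signed_perm R d q s a)).
Qed.

(** Both uses of convexity below bound an integrand by the symmetrized sum of a
function and of its image under one of the measure-preserving maps; integrating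
such a sum doubles the integral. *)
Lemma intRd_signed_perm_sum (R : realType) (d : nat) (q : 'S_d)
    (s : 'I_d -> bool) (a : 'rV[R]_d) (c : R) (f : 'rV[R]_d -> \bar R) :
  emeasurableRd f -> (forall x, 0 <= f x)%E -> 0 <= c ->
  intRd setT (fun x => c%:E * (f x + (f \o signed_perm q s a) x))%E =
  ((c * 2)%:E * intRd setT f)%E.
Proof.
move=> mf f0 c0.
have mfT := emeasurableRd_signed_perm _ _ q s a _ mf.
have fT0 x : (0 <= (f \o signed_perm q s a) x)%E by exact: f0.
rewrite intRdZl ?lee_fin//; last 2 first.
- exact: (emeasurableRdD _ _ _ _ mf mfT).
- by move=> x; rewrite adde_ge0.
rewrite (intRdD _ _ _ _ mf mfT f0 fT0) (intRd_signed_perm R d q s a f mf f0).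
by rewrite EFinM -muleA (_ : 2%:E = 1%:E + 1%:E)%E// ge0_muleDl ?lee_fin// mul1e.
Qed.

Lemma emeasurableRdM (R : realType) (d : nat) (f g : 'rV[R]_d -> \bar R) :
  emeasurableRd f -> emeasurableRd g ->
  emeasurableRd (fun x => f x * g x)%E.
Proof. by move=> mf mg; exact: emeasurable_funM. Qed.

(** * Measurability of continuous functions *)

(** An open set is a countable union of cubes with rational centres and radii.
The statement is about the preimage under a map with measurable coordinates so
that it covers the identity, translations, and the subtraction defined on the
product space. *)
Lemma measurable_preimage_open (disp : measure_display) (T : measurableType disp)
    (R : realType) (d : nat) (g : T -> 'rV[R]_d) (U : set 'rV[R]_d) :
  (forall i, measurable_fun setT (fun t => g t 0 i)) -> open U ->
  measurable (g @^-1` U).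
Proof.
move=> mg oU.
pose cube (c : 'rV[rat]_d * rat) : set 'rV[R]_d :=
  [set x | forall i, `|x 0 i - ratr (c.1 0 i)| < ratr c.2].
have mcube c : measurable (g @^-1` cube c).
  rewrite (_ : _ @^-1` _ = \bigcap_(i in [set: 'I_d])
      ((fun t => g t 0 i) @^-1` `]ratr (c.1 0 i) - ratr c.2, ratr (c.1 0 i) + ratr c.2[)).
    apply: fin_bigcap_measurable => [|i _]; first exact: finite_finset.
    by rewrite -[X in measurable X]setTI; exact: mg.
  apply/seteqP; split => t /= h i; have := h i; rewrite /= in_itv/= ltr_distl//.
  exact.
rewrite (_ : _ @^-1` _ = \bigcup_(c in [set: 'rV[rat]_d * rat])
    (if `[< cube c `<=` U >] then g @^-1` cube c else set0)).
  apply: countable_bigcupT_measurable => // c.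
  by case: ifP.
apply/seteqP; split => t /=; last first.
  by move=> [c _]; case: ifP => // /asboolP cU; exact: cU.
move=> Ugt.
have /nbhs_ballP[e /= e0 eU] : nbhs (g t) U by exact: open_nbhs_nbhs.
have [r] := @rat_in_itvoo R 0 (e / 2) (divr_gt0 e0 (ltr0n _ 2)).
rewrite in_itv/= => /andP[r0 re].
have qi i : exists q : rat, `|g t 0 i - ratr q| < ratr r :> R.
  have [|q] := @rat_in_itvoo R (g t 0 i - ratr r) (g t 0 i + ratr r).
    by rewrite ltrD2l (lt_trans _ r0)// oppr_lt0.
  rewrite in_itv/= => qI; exists q.
  by rewrite distrC ltr_distl.
(* A cube of radius r < e / 2 that contains g t lies in the e-ball around it. *)
pose c := (\row_i (sval (cid (qi i))), r).
have gc : cube c (g t).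
  by move=> i; rewrite /= mxE; case: (cid (qi i)).
exists c => //; rewrite asboolT//.
move=> x cx; apply: eU; split => // i j; rewrite !ord1 /ball/=.
rewrite (_ : g t 0 j - x 0 j = (g t 0 j - ratr (c.1 0 j)) - (x 0 j - ratr (c.1 0 j))); last by ring.
apply: (le_lt_trans (ler_normB _ _)).
have := gc j; have := cx j; rewrite /=; lra.
Qed.

Lemma measurable_continuous_comp (disp : measure_display) (T : measurableType disp)
    (R : realType) (d : nat) (g : T -> 'rV[R]_d) (f : 'rV[R]_d -> R) :
  (forall i, measurable_fun setT (fun t => g t 0 i)) -> continuous f ->
  measurable_fun setT (f \o g).
Proof.
move=> mg cf; apply: (measurability _ (RGenOInfty.measurableE R)).
move=> _ [_ [x ->] <-]; rewrite setTI comp_preimage.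
apply: measurable_preimage_open => //.
by apply: open_comp => [y _|]; [exact: cf|exact: interval_open].
Qed.

(** * Convexity of the p-th power *)

Lemma powR_midpoint_le (R : realType) (p a b : R) : 1 <= p -> 0 <= a -> 0 <= b ->
  ((a + b) / 2) `^ p <= (a `^ p + b `^ p) / 2.
Proof.
move=> p1 a0 b0.
have E : 1 - 2^-1 = 2^-1 :> R by rewrite {1}(splitr 1) div1r addrK.
have h1 : 0 <= 2^-1 :> R by rewrite invr_ge0.
have h2 : 2^-1 <= 1 :> R by rewrite invf_le1// ler1n.
have : (2^-1 * a + (1 - 2^-1) * b) `^ p <= 2^-1 * a `^ p + (1 - 2^-1) * b `^ p.
  by apply: (convex_powR p1 (Itv01 h1 h2)); rewrite inE/= in_itv/= andbT.
by rewrite E ![_ / 2]mulrC !mulrDr.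
Qed.

Lemma powR_addr_le (R : realType) (p a b : R) : 1 <= p -> 0 <= a -> 0 <= b ->
  (a + b) `^ p <= 2 `^ p / 2 * (a `^ p + b `^ p).
Proof.
move=> p1 a0 b0.
rewrite -[X in X `^ _ <= _](@mulfVK _ 2)// powRM ?divr_ge0 ?addr_ge0//.
rewrite mulrC -mulrA (mulrC _ (a `^ p + _)) ler_wpM2l ?powR_ge0//.
exact: powR_midpoint_le.
Qed.

(** * Energy of a translation *)

Lemma measurable_powR_diff (disp : measure_display) (T : measurableType disp)
    (R : realType) (d : nat) (p : R) (u : 'rV[R]_d -> R) (g h : T -> 'rV[R]_d) :
  continuous u ->
  (forall i, measurable_fun setT (fun t => g t 0 i)) ->
  (forall i, measurable_fun setT (fun t => h t 0 i)) ->
  measurable_fun setT (fun t => `|u (g t) - u (h t)| `^ p).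
Proof.
move=> cu mg mh.
apply: (measurableT_comp (measurable_powR p)).
apply: measurableT_comp => //.
by apply: measurable_funB; exact: (measurable_continuous_comp _ _ _ _ _ u).
Qed.

Lemma measurable_coordB (R : realType) (d : nat) (h : 'rV[R]_d) (i : 'I_d) :
  measurable_fun [set: lebRd R d] ((fun x : 'rV[R]_d => (x - h) 0 i) : lebRd R d -> R).
Proof.
rewrite (_ : (fun x : 'rV[R]_d => _) = (fun x => x 0 i - h 0 i)); last first.
  by apply/funext => x; rewrite !mxE.
apply: measurable_funB => //; exact: measurable_coord.
Qed.

Lemma measurable_powR_abs (R : realType) (d : nat) (p : R) (u : 'rV[R]_d -> R) :
  continuous u -> emeasurableRd (fun x => (`|u x| `^ p)%:E).
Proof.
move=> cu; apply: emeasurableRd_EFin.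
have mu := measurable_continuous_comp _ (lebRd R d) R d id u (measurable_coord R d) cu.
exact: (measurableT_comp (measurable_powR p) (measurableT_comp (@normr_measurable R setT) mu)).
Qed.

Definition shift_energy {R : realType} {d : nat} (p : R) (u : 'rV[R]_d -> R)
    (h : 'rV[R]_d) : \bar R :=
  intRd setT (fun x => (`|u x - u (x - h)| `^ p)%:E).

Lemma measurable_shift_diff (R : realType) (d : nat) (p : R) (u : 'rV[R]_d -> R)
    (h : 'rV[R]_d) : continuous u ->
  emeasurableRd (fun x => (`|u x - u (x - h)| `^ p)%:E).
Proof.
move=> cu; apply: emeasurableRd_EFin.
exact: (measurable_powR_diff _ (lebRd R d) R d p u id (fun x => x - h) cu
  (measurable_coord R d) (measurable_coordB R d h)).
Qed.

(** The difference over [2h] is the sum of two differences over [h], the second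
being a translate of the first. The factor [2 `^ p / 2] of [powR_addr_le]
compensates for having two terms, which keeps the sharp exponent: any larger
power of 2 would spoil the lower bound in terms of [|h.e|^p]. *)
Lemma shift_energy_double (R : realType) (d : nat) (p : R) (u : 'rV[R]_d -> R)
    (h : 'rV[R]_d) : 1 <= p -> continuous u ->
  (shift_energy p u (h *+ 2) <= (2 `^ p)%:E * shift_energy p u h)%E.
Proof.
move=> p1 cu.
pose f x := (`|u x - u (x - h)| `^ p)%:E.
pose T := signed_perm 1%g (fun=> false) (- h).
have TE x : T x = x - h.
  by apply/rowP => i; rewrite !mxE perm1 expr0 mul1r.
have f0 x : (0 <= f x)%E by rewrite lee_fin powR_ge0.
have mf : emeasurableRd f.
  exact: measurable_shift_diff.
have mfT : emeasurableRd (f \o T).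
  exact: emeasurableRd_signed_perm.
have -> : ((2 `^ p)%:E * shift_energy p u h =
    intRd setT (fun x => (2 `^ p / 2)%:E * (f x + (f \o T) x)))%E.
  by rewrite intRd_signed_perm_sum ?divr_ge0 ?powR_ge0// divfK.
apply: le_intRd => [||x|x].
- exact: measurable_shift_diff.
- exact: (emeasurableRdZ _ _ _ _ (emeasurableRdD _ _ _ _ mf mfT)).
- by rewrite lee_fin powR_ge0.
rewrite /= /f TE -EFinD -EFinM lee_fin.
apply: le_trans (powR_addr_le _ _ _ _ p1 (normr_ge0 _) (normr_ge0 _)).
apply: ge0_ler_powR; rewrite ?nnegrE ?addr_ge0 ?(le_trans _ p1)//.
rewrite mulr2n opprD addrA; apply: le_trans (ler_normD _ _).
by rewrite (_ : u x - u (x - h - h) = u x - u (x - h) + (u (x - h) - u (x - h - h)))//; ring.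
Qed.

Lemma shift_energy_ge0 (R : realType) (d : nat) (p : R) (u : 'rV[R]_d -> R)
    (h : 'rV[R]_d) : (0 <= shift_energy p u h)%E.
Proof. by apply: intRd_ge0 => x; rewrite lee_fin powR_ge0. Qed.

Lemma shift_energy_pow2 (R : realType) (d : nat) (p : R) (u : 'rV[R]_d -> R)
    (h : 'rV[R]_d) (k : nat) : 1 <= p -> continuous u ->
  (shift_energy p u (h *+ 2 ^ k) <=
     ((2 ^+ k) `^ p)%:E * shift_energy p u h)%E.
Proof.
move=> p1 cu; elim: k => [|k IH].
  by rewrite expr0 powR1 mul1e expn0.
rewrite expnSr mulrnA; apply: (le_trans (shift_energy_double _ _ _ _ _ p1 cu)).
have -> : (2 ^+ k.+1) `^ p = 2 `^ p * (2 ^+ k) `^ p :> R.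
  by rewrite exprS powRM.
rewrite EFinM -(muleA (2 `^ p)%:E).
by apply: lee_wpmul2l IH; rewrite lee_fin powR_ge0.
Qed.

(** If [u x] is nonzero, then [x] lies in the slab and [x - h] does not, so the
integrand at [x] is exactly [|u x|^p]. *)
Lemma shift_energy_disjoint (R : realType) (d : nat) (p r : R) (u : 'rV[R]_d -> R)
    (e h : 'rV[R]_d) : 0 <= p -> continuous u ->
  (forall x, u x != 0 -> `|dotv x e| <= r) -> 2 * r < `|dotv h e| ->
  (intRd setT (fun x => (`|u x| `^ p)%:E) <= shift_energy p u h)%E.
Proof.
move=> p0 cu ur hr.
apply: le_intRd => [||x|x].
- exact: measurable_powR_abs.
- exact: measurable_shift_diff.
- by rewrite lee_fin powR_ge0.
rewrite lee_fin ge0_ler_powR ?nnegrE//.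
have [->|ux] := eqVneq (u x) 0; first by rewrite normr0.
suff -> : u (x - h) = 0 by rewrite subr0.
apply/eqP; apply/negPn/negP => /ur xh.
have := ur _ ux; move: xh hr.
have -> : dotv (x - h) e = dotv x e - dotv h e.
  by rewrite /dotv -sumrB; apply: eq_bigr => i _; rewrite !mxE mulrBl.
move=> h1 h2 h3; have := ler_normB (dotv x e) (dotv x e - dotv h e).
rewrite subKr; lra.
Qed.

(** If [h.e] is nonzero, the least [k] with [2 ^ k |h.e| > 2r] satisfies [2 ^ k |h.e| <= M]: either
[k = 0], or the previous power is at most [2r] and doubling it gives at most
[4r]. *)
Lemma shift_energy_lower (R : realType) (d : nat) (p r M : R) (u : 'rV[R]_d -> R)
    (e h : 'rV[R]_d) : 1 <= p -> 0 < r -> continuous u ->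
  (forall x, u x != 0 -> `|dotv x e| <= r) ->
  `|dotv h e| <= M -> 4 * r <= M ->
  ((`|dotv h e| `^ p)%:E * intRd setT (fun x => (`|u x| `^ p)%:E) <=
   (M `^ p)%:E * shift_energy p u h)%E.
Proof.
move=> p1 r0 cu ur hM rM.
have p0 : 0 <= p by rewrite (le_trans _ p1).
have pn0 : p != 0 by rewrite gt_eqF// (lt_le_trans _ p1).
have [->|he0] := eqVneq (dotv h e) 0.
  by rewrite normr0 powR0// mul0e mule_ge0 ?shift_energy_ge0// lee_fin powR_ge0.
have hp : 0 < `|dotv h e| by rewrite normr_gt0.
have ex : exists k, 2 * r < 2 ^+ k * `|dotv h e|.
  exists (Num.truncn (2 * r / `|dotv h e|)).+1.
  rewrite -ltr_pdivrMr//; apply: lt_le_trans (truncnS_gt _) _.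
  by rewrite -natrX ler_nat ltnW// ltn_expl.
have [k hk kmin] := ex_minnP ex.
have kM : 2 ^+ k * `|dotv h e| <= M.
  case: k hk kmin => [|k] hk kmin; first by rewrite expr0 mul1r.
  rewrite exprS -mulrA.
  have : 2 ^+ k * `|dotv h e| <= 2 * r.
    by rewrite leNgt; apply/negP => /kmin; rewrite ltnn.
  lra.
have dk : `|dotv (h *+ 2 ^ k) e| = 2 ^+ k * `|dotv h e|.
  have -> : dotv (h *+ 2 ^ k) e = 2 ^+ k * dotv h e.
    rewrite /dotv mulr_sumr; apply: eq_bigr => i _.
    by rewrite mulmxnE -[in LHS]mulr_natl natrX mulrA.
  by rewrite normrM ger0_norm// exprn_ge0.
have := shift_energy_disjoint _ _ p r u e (h *+ 2 ^ k) p0 cu ur.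
rewrite dk => /(_ hk) /le_trans/(_ (shift_energy_pow2 _ _ _ _ _ k p1 cu)) H.
apply: (@le_trans _ _ ((`|dotv h e| `^ p)%:E * (((2 ^+ k) `^ p)%:E * shift_energy p u h))%E).
  by rewrite lee_wpmul2l// lee_fin powR_ge0.
rewrite muleA -EFinM -powRM// lee_wpmul2r ?shift_energy_ge0// lee_fin.
rewrite mulrC.
apply: ge0_ler_powR => //; rewrite nnegrE ?mulr_ge0 ?exprn_ge0//; lra.
Qed.

(** * Directional moments of a radial kernel *)

Lemma enorm_signed_perm (R : realType) (d : nat) (q : 'S_d) (s : 'I_d -> bool)
    (x : 'rV[R]_d) : enorm (signed_perm q s 0 x) = enorm x.
Proof.
rewrite /enorm /dotv; congr Num.sqrt.
rewrite [RHS](reindex_inj (@perm_inj _ q)); apply: eq_bigr => i _.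
by rewrite !mxE addr0 mulrACA -expr2 sqrr_sign mul1r.
Qed.

Lemma le_coord_enorm (R : realType) (d : nat) (x : 'rV[R]_d) (i : 'I_d) :
  `|x 0 i| <= enorm x.
Proof.
rewrite -sqrtr_sqr ler_wsqrtr// /dotv (bigD1 i)//= expr2 lerDl.
by apply: sumr_ge0 => j _; rewrite -expr2 sqr_ge0.
Qed.

Lemma enorm_eq0 (R : realType) (d : nat) (x : 'rV[R]_d) : (enorm x == 0) = (x == 0).
Proof.
apply/eqP/eqP => [x0|->].
  apply/rowP => i; rewrite mxE; apply/eqP; rewrite -normr_le0 -x0.
  exact: le_coord_enorm.
by rewrite /enorm /dotv big1 ?sqrtr0// => i _; rewrite mxE mul0r.
Qed.

Lemma abs_dotv_le (R : realType) (d : nat) (x e : 'rV[R]_d) :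
  `|dotv x e| <= d%:R * (enorm x * enorm e).
Proof.
apply: (le_trans (ler_norm_sum _ _ _)).
rewrite mulr_natl -[X in _ *+ X]card_ord -sumr_const; apply: ler_sum => i _.
by rewrite normrM ler_pM// le_coord_enorm.
Qed.

(** Both sides are compared with the largest coordinate. The index [i0] makes
the dimension positive. *)
Lemma enorm_powR_le (R : realType) (d : nat) (p : R) (x : 'rV[R]_d) (i0 : 'I_d) :
  0 <= p -> enorm x `^ p <= d%:R `^ p * \sum_(i < d) `|x 0 i| `^ p.
Proof.
move=> p0.
have [j _ jmax] := @Order.TotalTheory.arg_maxP _ R _ i0 xpredT (fun i => `|x 0 i|) isT.
apply: (@le_trans _ _ ((d%:R * `|x 0 j|) `^ p)).
  apply: ge0_ler_powR; rewrite ?nnegrE ?sqrtr_ge0 ?mulr_ge0//.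
  rewrite -[leRHS]ger0_norm ?mulr_ge0// -(sqrtr_sqr (d%:R * _)) ler_wsqrtr// exprMn.
  apply: (@le_trans _ _ (d%:R * `|x 0 j| ^+ 2)).
    rewrite /dotv mulr_natl -[X in _ *+ X]card_ord -sumr_const; apply: ler_sum => i _.
    by rewrite -expr2 -real_normK ?num_real// lerXn2r ?nnegrE//; exact: jmax.
  rewrite ler_wpM2r ?sqr_ge0// expr2 -natrM ler_nat leq_pmulr//.
  by case: d i0 {x j jmax} => [[]|].
rewrite powRM// ler_wpM2l ?powR_ge0// (bigD1 j)//= lerDl.
by apply: sumr_ge0 => *; rewrite powR_ge0.
Qed.

(** With a radial weight [g], this is used for [f] a coordinate, a linear form,
and the Euclidean norm. *)
Definition moment {R : realType} {d : nat} (p : R) (g : 'rV[R]_d -> R)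
    (f : 'rV[R]_d -> R) : \bar R :=
  intRd setT (fun h => (`|f h| `^ p * g h)%:E).

Lemma emeasurable_moment (R : realType) (d : nat) (p : R) (g f : 'rV[R]_d -> R) :
  measurable_funRd setT g -> measurable_funRd setT f ->
  emeasurableRd (fun h => (`|f h| `^ p * g h)%:E).
Proof.
move=> mg mf; apply: emeasurableRd_EFin.
apply: (measurable_funM _ mg).
exact: (measurableT_comp (measurable_powR p) (measurableT_comp (@normr_measurable R setT) mf)).
Qed.

Lemma measurable_dotv (R : realType) (d : nat) (e : 'rV[R]_d) :
  measurable_funRd setT (fun h => dotv h e).
Proof.
apply: measurable_sum => i.
by apply: measurable_funM => //; exact: measurable_coord.
Qed.

Lemma moment_coord_swap (R : realType) (d : nat) (p : R) (g : 'rV[R]_d -> R)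
    (i j : 'I_d) :
  measurable_funRd setT g -> (forall h, 0 <= g h) ->
  (forall x y, enorm x = enorm y -> g x = g y) ->
  moment p g (fun h => h 0 i) = moment p g (fun h => h 0 j).
Proof.
move=> mg g0 gr.
pose f (h : 'rV[R]_d) := (`|h 0 i| `^ p * g h)%:E.
rewrite /moment -(intRd_signed_perm R d (tperm i j) (fun=> false) 0 f).
- congr intRd; apply/funext => h.
  rewrite /f/= (gr _ _ (enorm_signed_perm R d (tperm i j) (fun=> false) h)).
  by rewrite mxE mul1r tpermL mxE addr0.
- exact: (emeasurable_moment _ _ _ _ _ mg (measurable_coord R d i)).
- by move=> h; rewrite lee_fin mulr_ge0 ?powR_ge0.
Qed.

(** Let [h'] be [h] with all coordinates but the [i]-th reversed. Then
[h.e + h'.e = 2 h_i e_i], and midpoint convexity bounds [|h_i e_i|^p] by the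
mean of [|h.e|^p] and [|h'.e|^p], which have the same integral against [g]. *)
Lemma moment_coord_le (R : realType) (d : nat) (p : R) (g : 'rV[R]_d -> R)
    (e : 'rV[R]_d) (i : 'I_d) : 1 <= p ->
  measurable_funRd setT g -> (forall h, 0 <= g h) ->
  (forall x y, enorm x = enorm y -> g x = g y) ->
  ((`|e 0%R i| `^ p)%:E * moment p g (fun h => h 0%R i) <=
   moment p g (fun h => dotv h e))%E.
Proof.
move=> p1 mg g0 gr.
have p0 : 0 <= p by rewrite (le_trans _ p1).
pose T : 'rV[R]_d -> 'rV[R]_d := signed_perm 1%g (fun k => k != i) 0.
pose f (h : 'rV[R]_d) := (`|dotv h e| `^ p * g h)%:E.
have mf : emeasurableRd f.
  exact: (emeasurable_moment _ _ _ _ _ mg (measurable_dotv R d e)).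
have mfT : emeasurableRd (f \o T).
  exact: emeasurableRd_signed_perm.
have f0 h : (0 <= f h)%E by rewrite lee_fin mulr_ge0 ?powR_ge0.
have mc := emeasurable_moment R d p g _ mg (measurable_coord R d i).
have c0 (h : 'rV[R]_d) : (0 <= (`|h 0%R i| `^ p * g h)%:E)%E by rewrite lee_fin mulr_ge0 ?powR_ge0.
have -> : moment p g (fun h => dotv h e) =
    intRd setT (fun h => (2^-1)%:E * (f h + (f \o T) h))%E.
  by rewrite intRd_signed_perm_sum ?invr_ge0// mulVf// mul1e.
have ei0 : (0 <= (`|e 0%R i| `^ p)%:E)%E by rewrite lee_fin powR_ge0.
rewrite /moment -(intRdZl _ _ _ _ mc c0 ei0).
apply: le_intRd => [||h|h].
- exact: (emeasurableRdZ _ _ _ _ mc).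
- exact: (emeasurableRdZ _ _ _ _ (emeasurableRdD _ _ _ _ mf mfT)).
- by rewrite mule_ge0// lee_fin powR_ge0.
rewrite /= /f (gr _ _ (enorm_signed_perm R d 1%g (fun k => k != i) h)).
rewrite -EFinD -!EFinM lee_fin -mulrDl !mulrA ler_wpM2r//.
rewrite [leRHS]mulrC -powRM//.
apply: le_trans (powR_midpoint_le _ _ _ _ p1 (normr_ge0 _) (normr_ge0 _)).
apply: ge0_ler_powR; rewrite ?nnegrE ?divr_ge0 ?addr_ge0 ?mulr_ge0//.
have E : dotv h e + dotv (T h) e = 2 * (e 0 i * h 0 i).
  rewrite /dotv -big_split/= (bigD1 i)//= big1 ?addr0 => [|k ki].
    by rewrite mxE eqxx perm1 expr0 mxE; ring.
  by rewrite mxE ki perm1 expr1 mxE; ring.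
have := ler_normD (dotv h e) (dotv (T h) e).
by rewrite E normrM normrM ger0_norm//; lra.
Qed.

Lemma measurable_enorm (R : realType) (d : nat) :
  measurable_funRd setT (@enorm R d).
Proof.
apply: (measurableT_comp (continuous_measurable_fun (@sqrt_continuous R))).
apply: measurable_sum => i.
by apply: measurable_funM; exact: measurable_coord.
Qed.

Lemma moment_enorm_le (R : realType) (d : nat) (p : R) (g : 'rV[R]_d -> R)
    (e : 'rV[R]_d) (i : 'I_d) : 1 <= p ->
  measurable_funRd setT g -> (forall h, 0 <= g h) ->
  (forall x y, enorm x = enorm y -> g x = g y) ->
  ((`|e 0%R i| `^ p)%:E * moment p g (@enorm R d) <=
   (d%:R `^ p * d%:R)%:E * moment p g (fun h => dotv h e))%E.
Proof.
move=> p1 mg g0 gr.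
have p0 : 0 <= p by rewrite (le_trans _ p1).
have mc k := emeasurable_moment R d p g _ mg (measurable_coord R d k).
have c0 k (h : 'rV[R]_d) : (0 <= (`|h 0%R k| `^ p * g h)%:E)%E.
  by rewrite lee_fin mulr_ge0 ?powR_ge0.
have msum : emeasurableRd (fun h => \sum_(k < d) (`|h 0%R k| `^ p * g h)%:E)%E.
  by apply: emeasurable_sum => k; exact: mc.
have dp0 : (0 <= (d%:R `^ p)%:E :> \bar R)%E by rewrite lee_fin powR_ge0.
have H : (moment p g (@enorm R d) <=
    (d%:R `^ p * d%:R)%:E * moment p g (fun h => h 0%R i))%E.
  apply: (@le_trans _ _ (intRd setT (fun h =>
      (d%:R `^ p)%:E * (\sum_(k < d) (`|h 0%R k| `^ p * g h)%:E)))%E).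
    apply: le_intRd => [||h|h].
    - exact: (emeasurable_moment _ _ _ _ _ mg (measurable_enorm R d)).
    - exact: (emeasurableRdZ _ _ _ _ msum).
    - by rewrite lee_fin mulr_ge0 ?powR_ge0.
    rewrite sumEFin -EFinM lee_fin -mulr_suml mulrA ler_wpM2r//.
    by rewrite ger0_norm ?sqrtr_ge0//; exact: enorm_powR_le.
  rewrite (intRdZl _ _ _ _ msum _ dp0) => [|h]; last by rewrite sume_ge0.
  rewrite (intRd_sum _ _ _ _ _ mc c0).
  under eq_bigr => k _ do rewrite [intRd _ _](moment_coord_swap R d p g k i mg g0 gr).
  by rewrite sumr_const card_ord EFinM -muleA mule_natl.
apply: (le_trans (lee_wpmul2l _ H)); first by rewrite lee_fin powR_ge0.
rewrite muleCA; apply: lee_wpmul2l.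
  by rewrite lee_fin mulr_ge0 ?powR_ge0.
exact: moment_coord_le.
Qed.

(** * The Poincaré inequality *)

Lemma measurable_shift_integrand (R : realType) (d : nat) (p : R)
    (u nu : 'rV[R]_d -> R) : continuous u -> measurable_funRd setT nu ->
  measurable_fun [set: lebRd R d * lebRd R d]
    (fun z : lebRd R d * lebRd R d =>
      (`|u (z.1 : 'rV[R]_d) - u ((z.1 : 'rV[R]_d) - (z.2 : 'rV[R]_d))| `^ p * nu z.2)%:E).
Proof.
move=> cu mnu; apply/measurable_EFinP.
apply: measurable_funM; last exact: (measurableT_comp mnu measurable_snd).
apply: (measurable_powR_diff _ (lebRd R d * lebRd R d)%type R d p u
  (fun z => z.1) (fun z => (z.1 : 'rV[R]_d) - (z.2 : 'rV[R]_d)) cu) => i.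
  exact: (measurableT_comp (measurable_coord R d i) measurable_fst).
have -> : (fun z : lebRd R d * lebRd R d => ((z.1 : 'rV[R]_d) - (z.2 : 'rV[R]_d)) 0 i) =
    (fun z => (z.1 : 'rV[R]_d) 0 i - (z.2 : 'rV[R]_d) 0 i).
  by apply/funext => z; rewrite !mxE.
apply: measurable_funB.
  exact: (measurableT_comp (measurable_coord R d i) measurable_fst).
exact: (measurableT_comp (measurable_coord R d i) measurable_snd).
Qed.

(** For fixed [x], the map [y -> x - y] is the signed permutation that reverses
every coordinate and then translates by [x]. Performing this substitution before
exchanging the integrals leaves the kernel depending on one variable only, so
its Lebesgue measurability suffices for joint measurability. *)
Lemma energy_shift (R : realType) (d : nat) (p : R) (u nu : 'rV[R]_d -> R) :
  continuous u -> measurable_funRd setT nu -> (forall h, 0 <= nu h) ->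
  intRd setT (fun x => intRd setT (fun y => (`|u x - u y| `^ p * nu (x - y))%:E)) =
  intRd setT (fun h => (nu h)%:E * shift_energy p u h)%E.
Proof.
move=> cu mnu nu0.
pose f (x h : 'rV[R]_d) := (`|u x - u (x - h)| `^ p * nu h)%:E.
have f0 x h : (0 <= f x h)%E by rewrite lee_fin mulr_ge0 ?powR_ge0.
have mf : measurable_fun [set: lebRd R d * lebRd R d] (fun z => f z.1 z.2).
  exact: measurable_shift_integrand.
transitivity (intRd setT (fun x => intRd setT (f x))).
  congr intRd; apply/funext => x.
  have mfx : emeasurableRd (f x).
    exact: (@measurableT_comp _ _ _ (lebRd R d) (lebRd R d * lebRd R d)%type _
      (fun z => f z.1 z.2) setT (pair (x : lebRd R d)) mf (pair1_measurable (x : lebRd R d))).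
  rewrite -(intRd_signed_perm R d 1%g (fun=> true) x (f x) mfx (f0 x)).
  congr intRd; apply/funext => y; rewrite /f/=.
  have -> : signed_perm 1%g (fun=> true) x y = x - y.
    by apply/rowP => i; rewrite !mxE perm1 expr1 mulN1r addrC.
  by rewrite subKr.
rewrite (intRd_fubini _ _ _ mf f0); congr intRd; apply/funext => h.
rewrite /shift_energy -intRdZl.
- by congr intRd; apply/funext => x; rewrite /f EFinM muleC.
- exact: measurable_shift_diff.
- by move=> x; rewrite lee_fin powR_ge0.
- by rewrite lee_fin.
Qed.

(** This is the measurability part of Tonelli's theorem, for the constant
kernel 1. *)
Lemma emeasurable_shift_energy (R : realType) (d : nat) (p : R)
    (u : 'rV[R]_d -> R) : continuous u -> emeasurableRd (shift_energy p u).
Proof.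
move=> cu.
pose f (x h : 'rV[R]_d) := (`|u x - u (x - h)| `^ p * 1)%:E.
have -> : shift_energy p u = (fun h => intRd setT (f^~ h)).
  by apply/funext => h; congr intRd; apply/funext => x; rewrite /f mulr1.
apply: emeasurableRd_fubini.
  have m1 : @measurable_funRd R d setT (fun=> 1) by exact: measurable_cst.
  exact: (measurable_shift_integrand R d p u (fun=> 1) cu m1).
by move=> x h; rewrite lee_fin mulr_ge0 ?powR_ge0.
Qed.

(** The support condition on [g] restricts to [|h| <= 1], where
[|h.e| <= d <= d + 4r]; there [shift_energy_lower] can be integrated
against [g]. *)
Lemma poincare_radial (R : realType) (d : nat) (p r : R) (u g : 'rV[R]_d -> R)
    (e : 'rV[R]_d) (i : 'I_d) : 1 <= p -> 0 < r -> enorm e = 1 -> continuous u ->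
  (forall x, u x != 0 -> `|dotv x e| <= r) ->
  measurable_funRd setT g -> (forall h, 0 <= g h) ->
  (forall x y, enorm x = enorm y -> g x = g y) ->
  (forall h, 1 < enorm h -> g h = 0) ->
  ((`|e 0%R i| `^ p)%:E * moment p g (@enorm R d) *
     intRd setT (fun x => (`|u x| `^ p)%:E) <=
   (d%:R `^ p * d%:R * (d%:R + 4 * r) `^ p)%:E *
     intRd setT (fun h => (g h)%:E * shift_energy p u h))%E.
Proof.
move=> p1 r0 e1 cu ur mg g0 gr gsupp.
have dp0 : (0 <= (d%:R `^ p * d%:R)%:E :> \bar R)%E by rewrite lee_fin mulr_ge0 ?powR_ge0.
have Mp0 : (0 <= ((d%:R + 4 * r) `^ p)%:E :> \bar R)%E by rewrite lee_fin powR_ge0.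
set U := intRd setT (fun x => (`|u x| `^ p)%:E).
have U0 : (0 <= U)%E by apply: intRd_ge0 => x; rewrite lee_fin powR_ge0.
apply: (le_trans (lee_wpmul2r U0 (moment_enorm_le R d p g e i p1 mg g0 gr))).
rewrite (EFinM (d%:R `^ p * d%:R)) -!(muleA (d%:R `^ p * d%:R)%:E).
apply: lee_wpmul2l => //.
have mdot := emeasurable_moment R d p g _ mg (measurable_dotv R d e).
have dot0 h : (0 <= (`|dotv h e| `^ p * g h)%:E)%E by rewrite lee_fin mulr_ge0 ?powR_ge0.
have mgs : emeasurableRd (fun h => (g h)%:E * shift_energy p u h)%E.
  apply: emeasurableRdM; first exact: emeasurableRd_EFin.
  exact: emeasurable_shift_energy.
have gs0 h : (0 <= (g h)%:E * shift_energy p u h)%E.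
  by rewrite mule_ge0 ?lee_fin// shift_energy_ge0.
rewrite muleC -(intRdZl _ _ _ _ mdot dot0 U0) -(intRdZl _ _ _ _ mgs gs0 Mp0).
apply: le_intRd => [||h|h].
- exact: (emeasurableRdZ _ _ _ _ mdot).
- exact: (emeasurableRdZ _ _ _ _ mgs).
- by rewrite mule_ge0.
have [h1|h1] := leP (enorm h) 1; last by rewrite gsupp// mulr0 mule0 mul0e mule0.
rewrite [leRHS]muleCA (EFinM _ (g h)) (muleC U) (muleC _ (g h)%:E).
rewrite -(muleA (g h)%:E).
apply: lee_wpmul2l; first by rewrite lee_fin.
apply: (shift_energy_lower _ _ _ r) => //; last first.
  by rewrite lerDr.
apply: (le_trans (abs_dotv_le _ _ _ _)); rewrite e1 mulr1.
apply: (@le_trans _ _ d%:R); first by rewrite ler_piMr.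
by rewrite lerDl mulr_ge0// ltW.
Qed.

Lemma measurable_nonzero (R : realType) (d : nat) :
  measurable ([set h : 'rV[R]_d | h != 0] : set (lebRd R d)).
Proof.
rewrite (_ : mkset _ = @enorm R d @^-1` (~` [set 0])).
  rewrite -[X in measurable X]setTI; apply: measurable_enorm => //.
  exact: measurableC.
by apply/seteqP; split => h /=; rewrite -enorm_eq0; [move/eqP|move=> ?; apply/eqP].
Qed.

Lemma measurable_enorm_le (R : realType) (d : nat) (a : R) :
  measurable ([set h : 'rV[R]_d | enorm h <= a] : set (lebRd R d)).
Proof.
rewrite (_ : mkset _ = @enorm R d @^-1` `]-oo, a]).
  by rewrite -[X in measurable X]setTI; exact: measurable_enorm.
by apply/seteqP; split => h /=; rewrite in_itv.
Qed.

(** On the unit ball the weight [1 /\ |h|^p] is [|h|^p], so the total mass 1 is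
the sum of the truncated moment and of the tail outside the ball. *)
Lemma moment_unit_ball_ge (R : realType) (d : nat) (p : R) (nu : 'rV[R]_d -> R) :
  0 < p -> measurable_funRd setT nu -> (forall h, 0 <= nu h) ->
  let w (h : 'rV[R]_d) : \bar R := (Num.min 1 (enorm h `^ p) * nu h)%:E in
  intRd setT w = 1%E ->
  (intRd [set h | (1 < enorm h)%R] w < (2^-1)%:E)%E ->
  ((2^-1)%:E <= moment p (nu \_ [set h | (enorm h <= 1)%R]) (@enorm R d))%E.
Proof.
move=> p0 mnu nu0 w w1 tail.
have one_p : 1 `^ p = 1 :> R by rewrite powR1.
set g := nu \_ _.
have gE h : g h = if enorm h <= 1 then nu h else 0.
  by rewrite /g patchE; congr (if _ then _ else _); apply/idP/idP; rewrite inE.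
have g0 h : 0 <= g h by rewrite gE; case: ifP.
have mD := measurable_enorm_le R d 1.
have mg : measurable_funRd setT g.
  by apply/(measurable_restrictT _ mD).1; exact: (measurable_funS measurableT _ mnu).
pose t := w \_ [set h | 1 < enorm h].
have tE h : t h = if enorm h <= 1 then 0%E else (nu h)%:E.
  rewrite /t patchE; have [h1|h1] := leP (enorm h) 1.
    by rewrite memNset//= ltNge h1.
  rewrite mem_set//= /w min_l ?mul1r//.
  by rewrite -[leLHS]one_p ge0_ler_powR ?nnegrE ?sqrtr_ge0 ?(ltW p0) ?(ltW h1).
have mt : emeasurableRd t.
  have -> : t = (fun h => (nu h)%:E) \_ (~` [set h | enorm h <= 1]).
    apply/funext => h; rewrite tE patchE in_setC.
    by case: ifPn => h1; [rewrite mem_set|rewrite memNset//=; exact/negP].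
  apply/(measurable_restrictT _ (measurableC mD)).1.
  exact: (measurable_funS measurableT _ (emeasurableRd_EFin _ _ _ mnu)).
have split_w : intRd setT w = (moment p g (@enorm R d) + intRd setT t)%E.
  rewrite /moment -(intRdD _ _ (fun h => (`|enorm h| `^ p * g h)%:E) t).
  - congr intRd; apply/funext => h; rewrite tE gE /w (ger0_norm (sqrtr_ge0 _)).
    have [h1|h1] := leP (enorm h) 1.
      rewrite adde0 min_r//.
      by rewrite -[leRHS]one_p ge0_ler_powR ?nnegrE ?sqrtr_ge0 ?(ltW p0).
    rewrite mulr0 add0e min_l ?mul1r//.
    by rewrite -[leLHS]one_p ge0_ler_powR ?nnegrE ?sqrtr_ge0 ?(ltW p0) ?(ltW h1).
  - exact: (emeasurable_moment _ _ _ _ _ mg (measurable_enorm R d)).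
  - exact: mt.
  - by move=> h; rewrite lee_fin mulr_ge0 ?powR_ge0.
  - by move=> h; rewrite tE; case: ifP => //; rewrite lee_fin.
have tailt : (intRd setT t < (2^-1)%:E)%E.
  by move: tail; rewrite /intRd integral_mkcond.
have m0 : (0 <= moment p g (@enorm R d))%E.
  by apply: intRd_ge0 => h; rewrite lee_fin mulr_ge0 ?powR_ge0.
have t0 : (0 <= intRd setT t)%E.
  by apply: intRd_ge0 => h; rewrite tE; case: ifP => //; rewrite lee_fin.
move: split_w tailt m0 t0; rewrite w1.
case: (moment _ _ _) => [a||] //; case: (intRd setT t) => [b||] //.
  by rewrite -EFinD !lee_fin lte_fin => -[]; lra.
Qed.

Lemma normLp_powR (R : realType) (d : nat) (p : R) (Omega : set 'rV[R]_d)
    (u : 'rV[R]_d -> R) : p != 0 -> (forall x, u x != 0 -> Omega x) ->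
  (normLp p Omega u `^ p)%E = intRd setT (fun x => (`|u x| `^ p)%:E).
Proof.
move=> p0 uO.
have uE : u \_ Omega = u.
  apply/funext => x; rewrite patchE; case: ifPn => // xO.
  apply/esym/eqP/negPn/negP => /uO Ox; move/negP: xO; apply.
  by rewrite inE.
rewrite /normLp uE.
exact: (poweR_Lnorm (@lebesgueRd R d) (EFin \o (u : lebRd R d -> R)) p0).
Qed.

Theorem theorem10p7 (R : realType) (d : nat) (p : R) (hp : 1 < p)
    (nu : R -> 'rV[R]_d -> R) (hnu : kernel_family p nu)
    (Omega : set 'rV[R]_d) (hOmega : open Omega)
    (e : 'rV[R]_d) (he : enorm e = 1) (r : R) (hr : 0 < r)
    (hH : Omega `<=` [set x | `|dotv x e| <= r]) :
  exists eps0 B : R, [/\ 0 < eps0, 0 < B &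
    forall (eps : R) (u : 'rV[R]_d -> R), 0 < eps < eps0 -> Cc_infty Omega u ->
      (normLp p Omega u `^ p <=
        B%:E * intRd setT (fun x => intRd setT (fun y =>
          (`|u x - u y| `^ p * nu eps (x - y))%:E)))%E].
Proof.
have p0 : 0 < p by rewrite (lt_trans _ hp).
have [i ei0] : exists i, e 0 i != 0.
  apply: contrapT => /forallNP e0.
  have : enorm e == 0.
    rewrite enorm_eq0; apply/eqP/rowP => i; rewrite mxE; apply/eqP.
    by apply/negPn/negP; exact: e0.
  by rewrite he oner_eq0.
have d0 : (0 < d)%N by apply: leq_ltn_trans (ltn_ord i).
have eip : 0 < `|e 0 i| `^ p by rewrite powR_gt0// normr_gt0.
have [hnu1 /(_ 1 ltr01) hnu2] := hnu.
have half_nbhs : nbhs (0%E : \bar R) [set y | (y < (2^-1)%:E)%E].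
  apply: open_nbhs_nbhs; split; first exact: open_ereal_lt_ereal.
  by rewrite /= lte_fin invr_gt0.
have [eps0 /= eps00 heps0] := hnu2 _ half_nbhs.
pose C := d%:R `^ p * d%:R * (d%:R + 4 * r) `^ p.
have C0 : 0 < C.
  by rewrite /C !mulr_gt0 ?powR_gt0 ?ltr0n// addr_gt0 ?ltr0n// mulr_gt0.
(* [C] is the constant of [poincare_radial]; the factor 2 pays for the moment
   of the truncated kernel, which is only known to be at least 1/2. *)
exists eps0, (2 * C / `|e 0 i| `^ p); split => //.
  by rewrite divr_gt0// mulr_gt0.
move=> eps u /andP[eps_gt0 eps_lt] [uCk _ usupp].
have cu : continuous u := uCk 0%N.
have ur x : u x != 0 -> `|dotv x e| <= r.
  by move=> ux; apply: hH; apply: usupp; exact: subset_closure.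
have [mnu nu0 nur nu1] := hnu1 _ eps_gt0.
have tail : (intRd [set h | (1 < enorm h)%R]
      (fun h => (Num.min 1 (enorm h `^ p) * nu eps h)%:E) < (2^-1)%:E)%E.
  by apply: heps0 => //=; rewrite sub0r normrN gtr0_norm.
(* The origin is given the value 0, so that the kernel becomes measurable and
   radial on the whole space without changing the integrals. *)
pose nut := nu eps \_ [set h | h != 0].
have nutE h : nut h = if h != 0 then nu eps h else 0.
  by rewrite /nut patchE; congr (if _ then _ else _); apply/idP/idP; rewrite inE.
have nut0 h : 0 <= nut h by rewrite nutE; case: ifP => // /nu0.
have mnut : measurable_funRd setT nut.
  exact/(measurable_restrictT _ (measurable_nonzero R d)).1.
have nutr x y : enorm x = enorm y -> nut x = nut y.
  move=> xy; rewrite !nutE -[x == 0]enorm_eq0 -[y == 0]enorm_eq0 xy.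
  by case: ifP => // y0; apply: nur => //; rewrite -enorm_eq0 ?xy.
have wE : (fun h => (Num.min 1 (enorm h `^ p) * nu eps h)%:E) =
    (fun h => (Num.min 1 (enorm h `^ p) * nut h)%:E).
  apply/funext => h; rewrite nutE; case: eqVneq => // h0.
  have /eqP -> : enorm h == 0 by rewrite enorm_eq0 h0.
  by rewrite powR0 ?gt_eqF// min_r// !mul0r.
rewrite wE in nu1 tail.
pose g := nut \_ [set h | enorm h <= 1].
have gE h : g h = if enorm h <= 1 then nut h else 0.
  by rewrite /g patchE; congr (if _ then _ else _); apply/idP/idP; rewrite inE.
have g0 h : 0 <= g h by rewrite gE; case: ifP.
have gnut h : g h <= nut h by rewrite gE; case: ifP.
have mg : measurable_funRd setT g.
  apply/(measurable_restrictT _ (measurable_enorm_le R d 1)).1.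
  exact: (measurable_funS measurableT _ mnut).
have gr x y : enorm x = enorm y -> g x = g y.
  by move=> xy; rewrite !gE xy (nutr _ _ xy).
have gsupp h : 1 < enorm h -> g h = 0 by rewrite gE ltNge => /negbTE ->.
have Emom := moment_unit_ball_ge R d p nut p0 mnut nut0 nu1 tail.
rewrite -/g in Emom.
rewrite normLp_powR ?gt_eqF//; last by move=> x ux; apply: usupp; exact: subset_closure.
have -> : intRd setT (fun x => intRd setT (fun y => (`|u x - u y| `^ p * nu eps (x - y))%:E)) =
  intRd setT (fun h => (nut h)%:E * shift_energy p u h)%E.
  rewrite -energy_shift//; congr intRd; apply/funext => x; congr intRd; apply/funext => y.
  rewrite nutE subr_eq0; case: eqVneq => // ->.
  by rewrite subrr normr0 powR0 ?gt_eqF// !mul0r.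
have U0 : (0 <= intRd setT (fun x => (`|u x| `^ p)%:E))%E.
  by apply: intRd_ge0 => x; rewrite lee_fin powR_ge0.
have := poincare_radial R d p r u g e i (ltW hp) hr he cu ur mg g0 gr gsupp.
rewrite -/C.
set U := intRd setT (fun x => _) in U0 *.
set E := intRd setT (fun h => (nut h)%:E * _)%E.
have gE' : (intRd setT (fun h => (g h)%:E * shift_energy p u h) <= E)%E.
  have mse := emeasurable_shift_energy R d p u cu.
  apply: le_intRd => [||h|h].
  - exact: (emeasurableRdM _ _ _ _ (emeasurableRd_EFin _ _ _ mg) mse).
  - exact: (emeasurableRdM _ _ _ _ (emeasurableRd_EFin _ _ _ mnut) mse).
  - apply: mule_ge0; last exact: shift_energy_ge0.
    by rewrite lee_fin; exact: g0.
  - apply: lee_wpmul2r; first exact: shift_energy_ge0.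
    by rewrite lee_fin; exact: gnut.
move=> key.
have {}key : ((`|e 0%R i| `^ p / 2)%:E * U <= C%:E * E)%E.
  apply: le_trans (le_trans key _).
    apply: lee_wpmul2r => //; rewrite EFinM; exact: lee_wpmul2l.
  apply: lee_wpmul2l; last exact: gE'.
  by rewrite lee_fin ltW.
rewrite -(@lee_pmul2l _ (`|e 0%R i| `^ p / 2)%:E)//; last first.
  by rewrite lte_fin divr_gt0.
apply: (le_trans key); rewrite muleA -EFinM.
suff -> : `|e 0 i| `^ p / 2 * (2 * C / `|e 0 i| `^ p) = C by [].
by field; exact: lt0r_neq0.
Qed.
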